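(* Let $\Lambda$ be a basic finite dimensional algebra over a field $K$, let $\mathfrak{A}\subseteq \Lambda\text{-mod}$ be a full subcategory which is closed under finite direct sums, and let $X\in\Lambda\text{-mod}$. Then the following conditions are equivalent: (1) $X$ fails to have an $\mathfrak{A}$-approximation. (2) There exists a countable subclass $\mathfrak{C}\subseteq\mathfrak{A}$ such that $X$ has an effective $\mathfrak{C}$-phantom of countably infinite $K$-dimension relative to $\mathfrak{A}$. (3) $X$ has an $\mathfrak{A}$-phantom of infinite $K$-dimension.
   Context: $\Lambda\text{-mod}$ is the category of finitely generated left $\Lambda$-modules, and $\Lambda\text{-Mod}$ the category of all left $\Lambda$-modules. ''Direct limits'' are colimits over directed index sets. Let $\mathfrak{A}\subseteq\Lambda\text{-mod}$ be a full subcategory closed under finite direct sums, let $\widehat{\mathfrak{A}}$ denote the closure of $\mathfrak{A}$ under direct limits in $\Lambda\text{-Mod}$, let $\mathfrak{C}\subseteq\mathfrak{A}$ be a full subcategory (equivalently, a subclass of objects of $\mathfrak{A}$), and let $X\in\Lambda\text{-mod}$. (a) A (right) $\mathfrak{C}$-approximation of $X$ inside $\mathfrak{A}$ (resp. inside $\widehat{\mathfrak{A}}$) is a homomorphism $f:A\to X$ with $A$ in $\mathfrak{A}$ (resp. $A$ in $\widehat{\mathfrak{A}}$) such that each homomorphism $g: C\to X$ with $C$ in $\mathfrak{C}$ factors through $f$. If $\mathfrak{C}=\mathfrak{A}$, a $\mathfrak{C}$-approximation of $X$ inside $\mathfrak{A}$ is simply called an $\mathfrak{A}$-approximation of $X$.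 (b) A $\mathfrak{C}$-phantom of $X$ relative to $\mathfrak{A}$ of the first kind is an object $B$ of $\Lambda\text{-mod}$ (not necessarily in $\mathfrak{A}$) for which there exists a finite non-empty set $\mathfrak{C}(B)\subseteq\mathfrak{C}$ such that, for each $\mathfrak{C}(B)$-approximation $f:A\to X$ of $X$ inside $\mathfrak{A}$, the module $B$ is (isomorphic to) a subfactor of $A$. Any direct limit of $\mathfrak{C}$-phantoms of $X$ of the first kind is called a $\mathfrak{C}$-phantom of $X$ of the second kind. Both kinds are called $\mathfrak{C}$-phantoms of $X$ relative to $\mathfrak{A}$; if $\mathfrak{C}=\mathfrak{A}$ they are called $\mathfrak{A}$-phantoms of $X$. (c) A $\mathfrak{C}$-phantom $B$ of $X$ relative to $\mathfrak{A}$ is called effective if there exists a homomorphism $f:B\to X$ which is a $\mathfrak{C}$-approximation of $X$ inside $\widehat{\mathfrak{A}}$ (in particular, $B\in\widehat{\mathfrak{A}}$ in that case). *)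

(* Defs.v *)
From HB Require Import structures.
From mathcomp Require Import all_boot all_order all_algebra.
From mathcomp Require Import falgebra.

Set Implicit Arguments.
Unset Strict Implicit.
Unset Printing Implicit Defensive.

Import GRing.Theory.
Local Open Scope ring_scope.

(* A full subcategory of left R-modules is given by the class of its objects,
   which is not assumed to be closed under isomorphism.  MathComp-Analysis's
   [set] cannot be used here: [set (lmodType R)] is universe-inconsistent. *)
Definition module_class (R : nzRingType) := lmodType R -> Prop.

Section LeftIdeal.
Variables (K : fieldType) (L : falgType K).

Definition lideal_pred (e : L) : {pred L^o} :=
  fun x : L => x \in limg (amulr e).

Fact lideal_submod_closed (e : L) : submod_closed (lideal_pred e).
Proof.
split=> [|a x y]; rewrite !unfold_in; first exact: mem0v.
move=> /memv_imgP[u _ ->] /memv_imgP[v _ ->].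
apply/memv_imgP; exists (a * u + v); first exact: memvf.
by rewrite !lfunE /= mulrDl -mulrA.
Qed.

HB.instance Definition _ (e : L) :=
  GRing.isSubmodClosed.Build L L^o (lideal_pred e) (lideal_submod_closed e).

(* The left module Lambda e = {y * e | y in Lambda}. *)
Record lideal (e : L) :=
  LIdeal { lideal_val : L^o; _ : lideal_val \in lideal_pred e }.

HB.instance Definition _ (e : L) := [isSub for @lideal_val e].
HB.instance Definition _ (e : L) := [Choice of lideal e by <:].
HB.instance Definition _ (e : L) :=
  [SubChoice_isSubLmodule of lideal e by <:].

End LeftIdeal.

Definition isomorphic (R : nzRingType) (M N : lmodType R) : Prop :=
  exists f : {linear M -> N}, bijective f.

Definition is_idempotent (R : nzRingType) (e : R) : Prop := e * e = e.

Definition orthogonal_idem (R : nzRingType) (e f : R) : Prop :=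
  e * f = 0 /\ f * e = 0.

Definition primitive_idem (R : nzRingType) (e : R) : Prop :=
  [/\ is_idempotent e, e != 0 &
      forall f g : R, is_idempotent f -> is_idempotent g -> orthogonal_idem f g ->
        e = f + g -> f = 0 \/ g = 0].

(* Basic: 1 is a sum of orthogonal primitive idempotents e_i such that the
   indecomposable projectives Lambda e_i are pairwise non-isomorphic. *)
Definition basic_algebra (K : fieldType) (L : falgType K) : Prop :=
  exists (n : nat) (e : 'I_n -> L),
    [/\ forall i, primitive_idem (e i),
        forall i j, i != j -> orthogonal_idem (e i) (e j),
        \sum_(i < n) e i = 1 &
        forall i j, i != j -> ~ isomorphic (lideal (e i)) (lideal (e j))].

Section Modules.
Variable R : nzRingType.

Definition fg_module (M : lmodType R) : Prop :=
  exists (n : nat) (x : 'I_n -> M),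
    forall m : M, exists c : 'I_n -> R, m = \sum_(i < n) c i *: x i.

Definition finite_class (C : module_class R) : Prop :=
  exists (n : nat) (F : 'I_n -> lmodType R),
    forall M, C M <-> exists i, M = F i.

(* Finite classes, including the empty one, are countable. *)
Definition countable_class (C : module_class R) : Prop :=
  exists F : nat -> lmodType R, forall M, C M -> exists n, M = F n.

Definition is_direct_sum (n : nat) (M : 'I_n -> lmodType R) (S : lmodType R)
    : Prop :=
  exists iota : forall i, {linear M i -> S},
    (forall x : S, exists m : forall i, M i, x = \sum_(i < n) iota i (m i)) /\
    (forall m m' : forall i, M i,
       \sum_(i < n) iota i (m i) = \sum_(i < n) iota i (m' i) ->
       forall i, m i = m' i).

(* The case n = 0 puts a zero module in [A]. *)
Definition closed_under_finite_direct_sums (A : module_class R) : Prop :=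
  forall (n : nat) (M : 'I_n -> lmodType R),
    (forall i, A (M i)) -> exists2 S, A S & is_direct_sum M S.

(* A direct system over a directed preordered index set.  Taking j := i in
   [dsys_comp], by [dsys_id] the map [dsys_map le_ij] does not depend on the
   proof of [dsys_le i j]. *)
Record direct_system := DirectSystem {
  dsys_index : Type;
  dsys_le : dsys_index -> dsys_index -> Prop;
  dsys_refl : forall i, dsys_le i i;
  dsys_trans : forall i j k, dsys_le i j -> dsys_le j k -> dsys_le i k;
  dsys_inhabited : inhabited dsys_index;
  dsys_directed : forall i j, exists k, dsys_le i k /\ dsys_le j k;
  dsys_obj : dsys_index -> lmodType R;
  dsys_map : forall i j, dsys_le i j -> {linear dsys_obj i -> dsys_obj j};
  dsys_id : forall i (le_ii : dsys_le i i) x, dsys_map le_ii x = x;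
  dsys_comp : forall i j k (le_ij : dsys_le i j) (le_jk : dsys_le j k)
      (le_ik : dsys_le i k) x,
    dsys_map le_jk (dsys_map le_ij x) = dsys_map le_ik x }.

Arguments dsys_obj : clear implicits.

Definition is_cocone (D : direct_system) (N : lmodType R)
    (psi : forall i, {linear dsys_obj D i -> N}) : Prop :=
  forall i j (le_ij : dsys_le i j) x, psi j (dsys_map le_ij x) = psi i x.

Definition is_direct_limit (D : direct_system) (N : lmodType R) : Prop :=
  exists2 psi : forall i, {linear dsys_obj D i -> N}, is_cocone psi &
    forall (P : lmodType R) (chi : forall i, {linear dsys_obj D i -> P}),
      is_cocone chi ->
      (exists u : {linear N -> P}, forall i x, u (psi i x) = chi i x) /\
      (forall u v : {linear N -> P},
         (forall i x, u (psi i x) = chi i x) ->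
         (forall i x, v (psi i x) = chi i x) -> u =1 v).

(* The smallest class that contains [A] and is closed under direct limits. *)
Inductive direct_limit_closure (A : module_class R) : module_class R :=
| closure_base M : A M -> direct_limit_closure A M
| closure_limit (D : direct_system) M :
    (forall i, direct_limit_closure A (dsys_obj D i)) ->
    is_direct_limit D M -> direct_limit_closure A M.

(* [f] is a C-approximation of [X] inside [A]. *)
Definition is_approximation (A C : module_class R) (X M : lmodType R)
    (f : {linear M -> X}) : Prop :=
  A M /\ forall (N : lmodType R) (g : {linear N -> X}), C N ->
    exists h : {linear N -> M}, forall x, g x = f (h x).

(* [U] is, up to isomorphism, a submodule of [M] with factor module [B]. *)
Definition subfactor (B M : lmodType R) : Prop :=
  exists (U : lmodType R) (i : {linear U -> M}) (p : {linear U -> B}),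
    injective i /\ forall b, exists u, p u = b.

Definition phantom_first_kind (A C : module_class R) (X B : lmodType R)
    : Prop :=
  fg_module B /\
  exists CB : module_class R,
    [/\ finite_class CB, exists M, CB M, forall M, CB M -> C M &
        forall (M : lmodType R) (f : {linear M -> X}),
          is_approximation A CB f -> subfactor B M].

Definition phantom_second_kind (A C : module_class R) (X B : lmodType R)
    : Prop :=
  exists2 D : direct_system,
    (forall i, phantom_first_kind A C X (dsys_obj D i)) & is_direct_limit D B.

Definition is_phantom (A C : module_class R) (X B : lmodType R) : Prop :=
  phantom_first_kind A C X B \/ phantom_second_kind A C X B.

Definition effective_phantom (A C : module_class R) (X B : lmodType R)
    : Prop :=
  is_phantom A C X B /\
  exists f : {linear B -> X}, is_approximation (direct_limit_closure A) C f.

End Modules.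

Section Dimension.
Variables (K : fieldType) (L : falgType K) (M : lmodType L).

(* K acts on a Lambda-module through k |-> k%:A, that is, k *: 1 in Lambda. *)
Definition Kcomb (I : Type) (s : seq I) (c : I -> K) (b : I -> M) : M :=
  \sum_(i <- s) ((c i)%:A : L) *: b i.

Definition Kbasis (I : eqType) (b : I -> M) : Prop :=
  (forall (s : seq I) (c : I -> K), uniq s -> Kcomb s c b = 0 ->
     forall i, i \in s -> c i = 0) /\
  (forall m : M, exists (s : seq I) (c : I -> K), m = Kcomb s c b).

Definition infinite_Kdim : Prop :=
  ~ exists (n : nat) (b : 'I_n -> M), Kbasis b.

Definition countably_infinite_Kdim : Prop :=
  exists b : nat -> M, Kbasis b.

End Dimension.

(* Main.v *)
Require Import Defs.
From HB Require Import structures.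
From mathcomp Require Import all_boot all_order all_algebra.
From mathcomp Require Import ring_quotient generic_quotient falgebra boolp.

Set Implicit Arguments.
Unset Strict Implicit.
Unset Printing Implicit Defensive.

Import GRing.Theory.
Local Open Scope ring_scope.

(** Call a homomorphism into X with source in A an object over X; a C-approximation
    is an object over X through which all maps from members of C to X factor.

    Suppose X has no A-approximation.  A sequence of objects over X is built,
    with maps M_0 -> M_1 -> ... over X and a submodule B_n of each M_n, called its
    core.  The key notion is rigidity of the core: a map over X from M_n to an
    object over X with source in A never identifies two elements of B_n.
    Rigidity can be produced from any object U over X: among the maps over X
    from U to objects with source in A, take h with the largest kernel, which
    exists because U is finite dimensional; composing h with a further map over
    X cannot enlarge the kernel, so the image of h is rigid ([rigid_image]).
    To pass from M_n to M_(n+1), one applies this to the direct sum U of copies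
    of M_n that carry a spanning family of the finite dimensional space
    Hom(M_n, X), together with an object over X that does not factor through M_n;
    M_(n+1) is the target of h and B_(n+1) is the image of U ([next_stage]).

    Let N be the direct limit of the M_n and C the class of all M_n.  Every map
    from M_n to X factors through M_(n+1), hence through N, so N -> X is a
    C-approximation.  Each M_n maps into B_(n+1), so N is also the direct limit of
    the B_n.  Rigidity makes B_n a submodule of the source of every
    {M_n}-approximation, so that B_n is a C-phantom of the first kind and N one of
    the second kind.  Rigidity also makes the maps B_n -> B_(n+1) injective; they
    are not surjective, since otherwise the object adjoined at that step would
    factor through B_n, hence through M_n.  So N is a strictly increasing union
    of finite dimensional subspaces and has countably infinite dimension.

    Conversely, let M -> X be an A-approximation, with dim M = d.  It is an
    approximation for every subclass of A, so every phantom of the first kind is a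
    subfactor of M and has dimension at most d.  That d + 1 vectors are dependent
    passes to direct limits ([direct_limit_dim]), because finitely many elements
    of a direct limit come from one member of the system.  So no phantom has
    infinite dimension ([phantom_dim]). *)

(** * Finite and countable dimension over a field *)

Section LinearAlgebra.
Variables (K : fieldType) (V : lmodType K).
Implicit Types (b : nat -> V) (c : nat -> K) (v w : V) (S : V -> Prop).

(** Finite families are the initial segments of infinite sequences, which makes
    extending a family by one vector free of casts between index types. *)
Definition in_span n b v := exists c, v = \sum_(i < n) c i *: b i.

Definition indep n b :=
  forall c, \sum_(i < n) c i *: b i = 0 -> forall i, (i < n)%N -> c i = 0.

(** The dimension bound is stated as dependence of any d + 1 vectors, because in
    this form it passes to subfactors and to direct limits. *)
Definition dim_at_most d := forall b, ~ indep d.+1 b.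

Lemma in_span_gen n b i : (i < n)%N -> in_span n b (b i).
Proof.
move=> lt_in; exists (fun j => (j == i)%:R).
rewrite (bigD1 (Ordinal lt_in)) //= eqxx scale1r big1 ?addr0 // => j.
by rewrite -val_eqE /= => /negPf ->; rewrite scale0r.
Qed.

Lemma in_span_linear n b k v w :
  in_span n b v -> in_span n b w -> in_span n b (k *: v + w).
Proof.
move=> [c ->] [c' ->]; exists (fun i => k * c i + c' i).
rewrite scaler_sumr -big_split /=; apply: eq_bigr => i _.
by rewrite scalerDl scalerA.
Qed.

Lemma in_span0 n b : in_span n b 0.
Proof. by exists (fun=> 0); rewrite big1 // => i _; rewrite scale0r. Qed.

Lemma in_span_sum (I : Type) (s : seq I) (P : pred I) (k : I -> K)
    (F : I -> V) n b :
  (forall i, P i -> in_span n b (F i)) ->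
  in_span n b (\sum_(i <- s | P i) k i *: F i).
Proof.
move=> spF; elim/big_ind: _ => [|v w sp_v sp_w|i Pi]; first exact: in_span0.
  by rewrite -[v]scale1r; apply: in_span_linear.
by rewrite -[X in in_span _ _ X]addr0; apply: in_span_linear;
   [exact: spF | exact: in_span0].
Qed.

Lemma in_span_widen m n b v : (m <= n)%N -> in_span m b v -> in_span n b v.
Proof.
move=> le_mn [c ->]; apply: in_span_sum => i _.
by apply: in_span_gen; apply: leq_trans le_mn.
Qed.

Lemma in_span_eq n b b' v : (forall i, (i < n)%N -> b i = b' i) ->
  in_span n b v -> in_span n b' v.
Proof. by move=> eqb [c ->]; exists c; apply: eq_bigr => i _; rewrite eqb. Qed.

Lemma indep_eq n b b' : (forall i, (i < n)%N -> b i = b' i) ->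
  indep n b -> indep n b'.
Proof.
move=> eqb indb c sum0; apply: indb; rewrite -[RHS]sum0.
by apply: eq_bigr => i _; rewrite eqb.
Qed.

Lemma indepS n b : indep n b -> ~ in_span n b (b n) -> indep n.+1 b.
Proof.
move=> indb notsp c; rewrite big_ord_recr /= => sum0.
have cn0 : c n = 0.
  apply: contrapT => /eqP cn0; apply: notsp.
  exists (fun i => - (c n)^-1 * c i); apply: (scalerI cn0).
  rewrite scaler_sumr (eq_bigr (fun i : 'I_n => - (c i *: b i))) => [|i _].
    by rewrite sumrN; apply/eqP; rewrite -addr_eq0 addrC sum0.
  by rewrite scalerA mulrA mulrN mulfV // mulN1r scaleNr.
move: sum0; rewrite cn0 scale0r addr0 => /indb c0 i.
by rewrite ltnS leq_eqVlt => /orP[/eqP->|/c0].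
Qed.

Lemma indep_step b : (forall n, ~ in_span n b (b n)) -> forall n, indep n b.
Proof. by move=> notsp; elim=> [c _ []//|n IHn]; apply: indepS. Qed.

(** More vectors than spanning vectors are dependent: their coefficient matrix has
    more rows than columns, hence a nonzero row in its left kernel. *)
Lemma steinitz_exchange n m b a :
  (forall i, (i < m)%N -> in_span n b (a i)) -> indep m a -> (m <= n)%N.
Proof.
move=> sp inda; rewrite leqNgt; apply/negP => lt_nm.
have /choice[C aE] : forall i : 'I_m, exists c, a i = \sum_(j < n) c j *: b j.
  by move=> i; apply: sp.
pose Q : 'M_(m, n) := \matrix_(i, j) C i j.
have : kermx Q != 0.
  rewrite -mxrank_eq0 mxrank_ker -lt0n subn_gt0.
  exact: leq_ltn_trans (rank_leq_col _) lt_nm.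
case/rowV0Pn=> u /sub_kermxP uQ0 /negP[]; apply/eqP/rowP => i.
pose c k := oapp (u 0) 0 (insub k : option 'I_m).
have cE (k : 'I_m) : c k = u 0 k by rewrite /c valK.
rewrite mxE -cE; apply: inda => //.
under eq_bigr => k _ do rewrite cE aE scaler_sumr.
rewrite exchange_big big1 // => j _ /=.
under eq_bigr => k _ do rewrite scalerA.
rewrite -scaler_suml; move/rowP: uQ0 => /(_ j); rewrite !mxE => uQ0.
by rewrite (eq_bigr (fun k => u 0 k * Q k j)) ?uQ0 ?scale0r // => k _; rewrite mxE.
Qed.

Lemma dim_at_most_span n b : (forall v, in_span n b v) -> dim_at_most n.
Proof.
move=> sp a inda; suff: (n.+1 <= n)%N by rewrite ltnn.
by apply: (@steinitz_exchange n n.+1 b a).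
Qed.

Lemma indep_leq n m b : (m <= n)%N -> indep n b -> indep m b.
Proof.
move=> le_mn indb c sum0 i lt_im.
pose c' j := if (j < m)%N then c j else 0.
suff: c' i = 0 by rewrite /c' lt_im.
apply: indb; last exact: leq_trans le_mn.
rewrite -[RHS]sum0 [RHS](big_ord_widen _ (fun i => c i *: b i) le_mn).
rewrite [RHS]big_mkcond; apply: eq_bigr => j _; rewrite /c'.
by case: ifP; rewrite // scale0r.
Qed.

Lemma indep_dim d n b : dim_at_most d -> indep n b -> (n <= d)%N.
Proof.
move=> dimV indb; rewrite leqNgt; apply/negP => lt_dn.
exact: dimV (indep_leq lt_dn indb).
Qed.

Definition indep_in S n := exists2 b, indep n b & forall i, (i < n)%N -> S (b i).

(** A vector of S outside the span could be appended to the family. *)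
Lemma maximal_indep_span S n b :
  indep n b -> (forall i, (i < n)%N -> S (b i)) ->
  ~ indep_in S n.+1 -> forall v, S v -> in_span n b v.
Proof.
move=> indb Sb maxn v Sv; apply: contrapT => notsp; apply: maxn.
pose b' i := if (i < n)%N then b i else v.
have eqb i : (i < n)%N -> b i = b' i by rewrite /b' => ->.
exists b' => [|i].
  apply: indepS; first exact: indep_eq eqb indb.
  rewrite {2}/b' ltnn => sp; apply: notsp.
  by apply: in_span_eq sp => i /eqb.
by rewrite ltnS /b'; case: ltnP => [/Sb|].
Qed.

Lemma finite_span_in d S : dim_at_most d ->
  exists n b, [/\ indep n b, forall i, (i < n)%N -> S (b i) &
                  forall v, S v -> in_span n b v].
Proof.
move=> dimV; pose P n := `[< indep_in S n >].
have exP : exists n, P n by exists 0; apply/asboolP; exists (fun=> 0) => // c _ [].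
have ubP n : P n -> (n <= d)%N by move/asboolP=> [b /(indep_dim dimV)].
case: (ex_maxnP exP ubP) => n /asboolP[b indb Sb] maxn.
exists n, b; split=> //; apply: maximal_indep_span => // /asboolP /maxn.
by rewrite ltnn.
Qed.

Definition subspace S := S 0 /\ forall k v w, S v -> S w -> S (k *: v + w).

Lemma subspace_span S n b v : subspace S -> (forall i, (i < n)%N -> S (b i)) ->
  in_span n b v -> S v.
Proof.
move=> [S0 Slin] Sb [c ->]; elim/big_ind: _ => // [x y Sx Sy|i _].
  by rewrite -[x]scale1r; apply: Slin.
by rewrite -[_ *: _]addr0; apply: Slin => //; apply: Sb.
Qed.

(** In place of an ascending chain argument: a member that contains an independent
    family of the largest possible size is spanned by it, and so is every larger
    member. *)
Lemma maximal_subspace (I : Type) (S : I -> V -> Prop) d :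
  dim_at_most d -> inhabited I -> (forall i, subspace (S i)) ->
  exists i, forall j, (forall v, S i v -> S j v) -> forall v, S j v -> S i v.
Proof.
move=> dimV [i0] subS; pose P n := `[< exists i, indep_in (S i) n >].
have exP : exists n, P n.
  by exists 0; apply/asboolP; exists i0, (fun=> 0) => // c _ [].
have ubP n : P n -> (n <= d)%N by move/asboolP=> [i [b /(indep_dim dimV)]].
case: (ex_maxnP exP ubP) => n /asboolP[i [b indb Sb]] maxn.
exists i => j Sij v Sjv; apply: (subspace_span (subS i) Sb).
apply: (@maximal_indep_span (S j)) Sjv => // [k /Sb /Sij //|Pn].
have /maxn : P n.+1 by apply/asboolP; exists j.
by rewrite ltnn.
Qed.

Definition nat_basis b := (forall n, indep n b) /\ forall v, exists n, in_span n b v.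

(** The basis consists of the vectors e k that do not depend on the earlier ones:
    each step appends the first e k outside the span of what was chosen so far,
    which exists because no finite family spans. *)
Lemma nat_basis_exists e :
  (forall v, exists n, in_span n e v) ->
  (forall n b, exists v, ~ in_span n b v) -> exists b, nat_basis b.
Proof.
move=> spe inf.
have fresh n b : exists k, `[< ~ in_span n b (e k) >].
  apply: contrapT => /forallNP nofresh; have [v []] := inf n b.
  have [m [c ->]] := spe v; apply: in_span_sum => i _.
  by apply: contrapT => notsp; apply: (nofresh i); apply/asboolP.
pose step (s : seq V) := rcons s (e (ex_minn (fresh (size s) (nth 0 s)))).
pose L n := iter n step [::].
have szL n : size (L n) = n by elim: n => //= n IHn; rewrite size_rcons IHn.
pose b n := nth 0 (L n.+1) n.
have nthL n i : (i < n)%N -> nth 0 (L n) i = b i.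
  elim: n => // n IHn; rewrite ltnS leq_eqVlt => /orP[/eqP->//|lt_in].
  by rewrite /= nth_rcons szL lt_in IHn.
have bE n : b n = e (ex_minn (fresh (size (L n)) (nth 0 (L n)))).
  by rewrite /b /= nth_rcons szL ltnn eqxx.
have spb n i : (i < n)%N -> in_span n b (e i).
  elim: n i => // n IHn i; rewrite ltnS leq_eqVlt => /orP[/eqP->|/IHn]; last first.
    exact: in_span_widen.
  apply: contrapT => notsp; have := bE n.
  case: ex_minnP => k /asboolP; rewrite szL => fk mink bn.
  (* After n steps the first n vectors of e are in the span, by induction, so
     that the vector chosen next has index at least n. *)
  have lenk : (n <= k)%N.
    rewrite leqNgt; apply/negP => /IHn spk; apply: fk.
    by apply: in_span_eq spk => j /nthL.
  have fn : ~ in_span n (nth 0 (L n)) (e n).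
    move=> sp; apply: notsp; apply: (in_span_widen (leqnSn n)).
    by apply: in_span_eq sp => j /nthL.
  have /mink lekn : `[< ~ in_span n (nth 0 (L n)) (e n) >] by apply/asboolP.
  apply: notsp; have -> : n = k by apply/eqP; rewrite eqn_leq lenk lekn.
  by rewrite -bn; apply: in_span_gen; rewrite ltnS.
exists b; split=> [|v].
  apply: indep_step => n; rewrite [X in in_span _ _ X]bE.
  case: ex_minnP => k /asboolP fk _ sp; apply: fk; rewrite szL.
  by apply: in_span_eq sp => j /nthL.
have [m [c ->]] := spe v; exists m; apply: in_span_sum => i _.
exact: spb.
Qed.

End LinearAlgebra.

(** * Submodules, quotients and direct sums *)

Section ModuleConstructions.
Variable R : nzRingType.
Implicit Types U V W M N : lmodType R.

(** Many functions below come from choice and are only afterwards seen to be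
    linear. *)
Lemma linear_map_of U V (f : U -> V) : linear f ->
  exists g : {linear U -> V}, forall x, g x = f x.
Proof.
move=> lin.
pose g : {linear U -> V} := HB.pack f (GRing.isLinear.Build R U V *:%R f lin).
by exists g.
Qed.

Definition submodule V (S : V -> Prop) :=
  S 0 /\ forall a v w, S v -> S w -> S (a *: v + w).

Section Submodule.
Variables (V : lmodType R) (S : V -> Prop) (subS : submodule S).

(** The proof of closure is an argument so that the instance below can be attached
    to the predicate. *)
Definition submodule_pred of submodule S : {pred V} := fun v => `[< S v >].

Fact submodule_pred_closed : submod_closed (submodule_pred subS).
Proof.
case: (subS) => S0 Slin; split=> [|a v w]; first exact/asboolP.
by move=> /asboolP Sv /asboolP Sw; apply/asboolP/Slin.
Qed.

HB.instance Definition _ :=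
  GRing.isSubmodClosed.Build R V (submodule_pred subS) submodule_pred_closed.

Record submodule_type := SubmoduleElt {
  submodule_val : V; _ : submodule_val \in submodule_pred subS }.

HB.instance Definition _ := [isSub for submodule_val].
HB.instance Definition _ := [Choice of submodule_type by <:].
HB.instance Definition _ := [SubChoice_isSubLmodule of submodule_type by <:].

(** Classically S is a boolean predicate, so that the submodule is a subtype. *)
Lemma submodule_module : exists (U : lmodType R) (j : {linear U -> V}),
  injective j /\ forall v, S v <-> exists u, v = j u.
Proof.
exists submodule_type, (val : {linear submodule_type -> V}).
split=> [|v]; first exact: val_inj.
split=> [/asboolP Sv|[u ->]]; first by exists (SubmoduleElt Sv).
exact/asboolP/(valP u).
Qed.

End Submodule.

Lemma lift_to_submodule U V W (j : {linear U -> V}) (g : {linear W -> V}) :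
  injective j -> (forall w, exists u, g w = j u) ->
  exists h : {linear W -> U}, forall w, g w = j (h w).
Proof.
move=> inj_j /choice[h hE].
have lin : linear h by move=> a x y; apply: inj_j; rewrite linearP -!hE linearP.
by have [h' h'E] := linear_map_of lin; exists h' => w; rewrite h'E.
Qed.

Lemma image_factorization U V (g : {linear U -> V}) :
  exists (W : lmodType R) (p : {linear U -> W}) (j : {linear W -> V}),
    [/\ injective j, forall w, exists u, w = p u & forall u, g u = j (p u)].
Proof.
have [|W [j [inj_j jP]]] := @submodule_module V (fun v => exists u, v = g u) _.
  split=> [|a _ _ [u ->] [u' ->]]; first by exists 0; rewrite linear0.
  by exists (a *: u + u'); rewrite linearP.
have [|p pE] := lift_to_submodule (g := g) inj_j.
  by move=> u; apply/jP; exists u.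
exists W, p, j; split=> // w; have /jP[u ju] : exists u, j w = j u by exists w.
by exists u; apply: inj_j; rewrite ju.
Qed.

Section QuotientModule.
Variables (V : lmodType R) (S : V -> Prop) (subS : submodule S).

Definition quotient_type := @Quotient.quot V (submodule_pred subS).

HB.instance Definition _ := GRing.Zmodule.on quotient_type.

Let proj (v : V) : quotient_type := \pi_(Quotient.quot (submodule_pred subS))%qT v.

Fact projP v w : proj v = proj w <-> S (v - w).
Proof.
have e : (proj v == proj w) = (v - w \in submodule_pred subS).
  by rewrite Quotient.idealrBE.
by split=> [/eqP|Svw]; [|apply/eqP]; rewrite e; [move/asboolP|apply/asboolP].
Qed.

Definition quotient_scale (a : R) (q : quotient_type) := proj (a *: repr q).

Fact projD : {morph proj : v w / v + w}. Proof. by move=> v w; exact: raddfD. Qed.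

Fact projZ a v : quotient_scale a (proj v) = proj (a *: v).
Proof.
apply/projP; rewrite -scalerBr -[_ *: _]addr0.
have [S0 Slin] := subS; apply: Slin => //; apply/projP.
exact: reprK.
Qed.

Fact proj_surj q : q = proj (repr q).
Proof. by rewrite /proj reprK. Qed.

Fact quotient_scalerA a b q :
  quotient_scale a (quotient_scale b q) = quotient_scale (a * b) q.
Proof. by rewrite (proj_surj q) !projZ scalerA. Qed.

Fact quotient_scale1r : left_id 1 quotient_scale.
Proof. by move=> q; rewrite (proj_surj q) projZ scale1r. Qed.

Fact quotient_scalerDr : right_distributive quotient_scale +%R.
Proof.
by move=> a q q'; rewrite (proj_surj q) (proj_surj q') -projD !projZ scalerDr projD.
Qed.

Fact quotient_scalerDl q : {morph quotient_scale^~ q : a b / a + b}.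
Proof. by move=> a b; rewrite (proj_surj q) !projZ scalerDl projD. Qed.

HB.instance Definition _ := GRing.Zmodule_isLmodule.Build R quotient_type
  quotient_scalerA quotient_scale1r quotient_scalerDr quotient_scalerDl.

Lemma quotient_module : exists (Q : lmodType R) (p : {linear V -> Q}),
  forall v, p v = 0 <-> S v.
Proof.
have lin : linear (proj : V -> quotient_type).
  by move=> a v w; rewrite projD; congr (_ + _); rewrite -projZ.
have [p pE] := linear_map_of lin; exists quotient_type, p => v.
rewrite -(linear0 p) !pE -{2}[v]subr0; exact: projP.
Qed.

End QuotientModule.

(** The universal property of the direct sum; components are unique, which makes
    the map well defined and linear. *)
Lemma direct_sum_map n (M : 'I_n -> lmodType R) (S X : lmodType R)
    (g : forall i, {linear M i -> X}) (iota : forall i, {linear M i -> S}) :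
  (forall x : S, exists m : forall i, M i, x = \sum_(i < n) iota i (m i)) ->
  (forall m m' : forall i, M i,
     \sum_(i < n) iota i (m i) = \sum_(i < n) iota i (m' i) ->
     forall i, m i = m' i) ->
  exists F : {linear S -> X}, forall i x, F (iota i x) = g i x.
Proof.
move=> /choice[c cE] inj.
pose F x := \sum_(i < n) g i (c x i).
have lin : linear F.
  move=> a x y; rewrite /F scaler_sumr -big_split /=; apply: eq_bigr => i _.
  rewrite -linearP; congr (g i _).
  apply: (inj _ (fun i => a *: c x i + c y i)).
  rewrite -cE {1}(cE x) {1}(cE y) scaler_sumr -big_split.
  by apply: eq_bigr => k _; rewrite linearP.
have [F' F'E] := linear_map_of lin; exists F' => i x; rewrite F'E /F.
pose m := dfwith (fun k => 0 : M k) x.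
have mi : m i = x by exact: dfwith_in.
have mk k : k != i -> m k = 0 by move=> nki; rewrite /m dfwith_out // eq_sym.
have cm k : c (iota i x) k = m k.
  apply: inj; rewrite -cE (bigD1 i) //= mi big1 ?addr0 // => l /mk ->.
  exact: linear0.
by rewrite (bigD1 i) //= cm mi big1 ?addr0 // => l /mk m0; rewrite cm m0 linear0.
Qed.

End ModuleConstructions.

(** * Direct limits *)

Lemma dependent_choice (I : Type) (T : I -> Type) (P : forall i, T i -> Prop) :
  (forall i, exists x, P i x) -> exists f : forall i, T i, forall i, P i (f i).
Proof.
by move=> exP; exists (fun i => projT1 (cid (exP i))) => i; exact: projT2 (cid _).
Qed.

Section DirectLimits.
Variable R : nzRingType.
Implicit Types (D : direct_system R) (N : lmodType R).

(** The usual elementwise characterization of a direct limit: a cocone that is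
    jointly surjective and in which an element becomes zero only if it already
    becomes zero at some later index. *)
Section Criterion.
Variables (D : direct_system R) (N : lmodType R).
Variable psi : forall i, {linear @dsys_obj R D i -> N}.
Hypothesis cocone : is_cocone psi.
Hypothesis surj : forall y, exists i x, y = psi i x.
Hypothesis ker : forall i x, psi i x = 0 ->
  exists j (le_ij : dsys_le i j), dsys_map le_ij x = 0.

Lemma direct_limit_map (P : lmodType R)
    (chi : forall i, {linear @dsys_obj R D i -> P}) : is_cocone chi ->
  exists u : {linear N -> P}, forall i x, u (psi i x) = chi i x.
Proof.
move=> chi_cocone.
have psi_chi i x j y : psi i x = psi j y -> chi i x = chi j y.
  have [k [le_ik le_jk]] := dsys_directed i j.
  rewrite -(cocone le_ik) -(cocone le_jk) => /eqP.
  rewrite -subr_eq0 -linearB => /eqP /ker[l [le_kl]] /(congr1 (chi l)).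
  rewrite linear0 chi_cocone linearB => /eqP; rewrite subr_eq0 => /eqP.
  by rewrite !chi_cocone.
have /choice[r rE] : forall y : N, exists p : {i & @dsys_obj R D i},
    y = psi (projT1 p) (projT2 p).
  by move=> y; have [i [x ->]] := surj y; exists (existT _ i x).
pose u y := chi (projT1 (r y)) (projT2 (r y)).
have uE i x : u (psi i x) = chi i x by apply: psi_chi; rewrite -rE.
have lin : linear u.
  move=> a y y'; have [i [x ->]] := surj y; have [j [x' ->]] := surj y'.
  have [k [le_ik le_jk]] := dsys_directed i j.
  by rewrite -(cocone le_ik) -(cocone le_jk) -linearP !uE linearP.
by have [v vE] := linear_map_of lin; exists v => i x; rewrite vE.
Qed.

Lemma direct_limit_criterion : is_direct_limit D N.
Proof.
exists psi => // P chi chi_cocone; split; first exact: direct_limit_map.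
by move=> u v uE vE y; have [i [x ->]] := surj y; rewrite uE vE.
Qed.

End Criterion.

(** The union U of the images is a submodule through which the cocone factors.
    The resulting map from N to U, composed with the inclusion of U, is the
    identity by uniqueness, so U is everything. *)
Lemma direct_limit_surj D N : is_direct_limit D N ->
  exists2 psi : forall i, {linear @dsys_obj R D i -> N}, is_cocone psi &
    forall y, exists i x, y = psi i x.
Proof.
move=> [psi cocone univ]; exists psi => //.
have [|U [j [inj_j jP]]] :=
    @submodule_module R N (fun y => exists i x, y = psi i x) _.
  split=> [|a _ _ [i [x ->]] [i' [x' ->]]].
    have [i] := dsys_inhabited D.
    by exists i, 0; rewrite linear0.
  have [k [le_ik le_jk]] := dsys_directed i i'.
  exists k, (a *: dsys_map le_ik x + dsys_map le_jk x').
  by rewrite linearP !cocone.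
have /dependent_choice[chi chiE] : forall i, exists chi : {linear @dsys_obj R D i -> U},
    forall x, psi i x = j (chi x).
  by move=> i; apply: lift_to_submodule => // x; apply/jP; exists i, x.
have chi_cocone : is_cocone chi.
  by move=> i k le_ik x; apply: inj_j; rewrite -!chiE cocone.
have [[u uE] _] := univ _ _ chi_cocone.
have [_ uniq] := univ _ _ cocone.
move=> y; apply/jP; exists (u y).
by apply: (uniq idfun (j \o u)) => // i x /=; rewrite uE chiE.
Qed.

End DirectLimits.

Section ProductModule.
Variables (R : nzRingType) (M : nat -> lmodType R).

(** The full product of a sequence of modules, in which sequential direct limits are
    realized. *)
Definition product_type := forall n, M n.

HB.instance Definition _ := gen_eqMixin product_type.
HB.instance Definition _ := gen_choiceMixin product_type.

Fact product_addA :
  associative (fun x y : product_type => (fun n => x n + y n) : product_type).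
Proof. by move=> x y z; apply: functional_extensionality_dep => n; rewrite addrA. Qed.

Fact product_addC :
  commutative (fun x y : product_type => (fun n => x n + y n) : product_type).
Proof. by move=> x y; apply: functional_extensionality_dep => n; rewrite addrC. Qed.

Fact product_add0 : left_id ((fun=> 0) : product_type)
  (fun x y : product_type => (fun n => x n + y n) : product_type).
Proof. by move=> x; apply: functional_extensionality_dep => n; rewrite add0r. Qed.

Fact product_addN : left_inverse ((fun=> 0) : product_type)
  (fun x : product_type => (fun n => - x n) : product_type)
  (fun x y : product_type => (fun n => x n + y n) : product_type).
Proof. by move=> x; apply: functional_extensionality_dep => n; rewrite addNr. Qed.

HB.instance Definition _ := GRing.isZmodule.Build product_type
  product_addA product_addC product_add0 product_addN.

Definition product_scale (a : R) (x : product_type) : product_type :=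
  fun n => a *: x n.

Fact product_scalerA a b x :
  product_scale a (product_scale b x) = product_scale (a * b) x.
Proof. by apply: functional_extensionality_dep => n; rewrite /product_scale scalerA. Qed.

Fact product_scale1r : left_id 1 product_scale.
Proof.
by move=> x; apply: functional_extensionality_dep => n; rewrite /product_scale scale1r.
Qed.

Fact product_scalerDr : right_distributive product_scale +%R.
Proof.
by move=> a x y; apply: functional_extensionality_dep => n; exact: scalerDr.
Qed.

Fact product_scalerDl x : {morph product_scale^~ x : a b / a + b}.
Proof.
by move=> a b; apply: functional_extensionality_dep => n; exact: scalerDl.
Qed.

HB.instance Definition _ := GRing.Zmodule_isLmodule.Build R product_type
  product_scalerA product_scale1r product_scalerDr product_scalerDl.

Lemma product_linearE (a : R) (x y : product_type) n : (a *: x + y) n = a *: x n + y n.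
Proof. by []. Qed.

End ProductModule.

Section SequentialLimits.
Variable R : nzRingType.

(** The composite of the maps phi from index n to index m.  Shifting the whole
    sequence in the recursive calls avoids casts along equations between indices.
    The value for m < n is junk. *)
Fixpoint transition (M : nat -> lmodType R)
    (phi : forall n, {linear M n -> M n.+1}) (n m : nat) {struct m} :
    {linear M n -> M m} :=
  match m, n return {linear M n -> M m} with
  | 0, 0 => idfun
  | 0, n'.+1 => \0
  | m'.+1, 0 => transition (fun k => phi k.+1) 0 m' \o phi 0
  | m'.+1, n'.+1 => transition (fun k => phi k.+1) n' m'
  end.

Lemma transition_id M phi n x : @transition M phi n n x = x.
Proof. by elim: n M phi x => //= n IHn M phi x; rewrite IHn. Qed.

Lemma transitionS M phi n m x : (n <= m)%N ->
  @transition M phi n m.+1 x = phi m (transition phi n m x).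
Proof.
elim: m n M phi x => [|m IHm] [|n] M phi x //; rewrite ?ltnS => le_nm.
  exact: (IHm 0 _ (fun k => phi k.+1) (phi 0 x)).
exact: (IHm n _ (fun k => phi k.+1) x).
Qed.

Lemma transition_comp M phi n m p x : (n <= m)%N -> (m <= p)%N ->
  transition phi m p (@transition M phi n m x) = transition phi n p x.
Proof.
move=> le_nm; elim: p => [|p IHp]; rewrite leq_eqVlt => /orP[/eqP<-|].
- exact: transition_id.
- by [].
- exact: transition_id.
rewrite ltnS => le_mp; rewrite !transitionS ?IHp //.
exact: leq_trans le_mp.
Qed.

Lemma transition_cocone (M : nat -> lmodType R)
    (phi : forall n, {linear M n -> M n.+1}) (P : lmodType R)
    (chi : forall n, {linear M n -> P}) :
  (forall n x, chi n.+1 (phi n x) = chi n x) ->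
  forall n m x, (n <= m)%N -> chi m (transition phi n m x) = chi n x.
Proof.
move=> chi_phi n m x; elim: m => [|m IHm]; rewrite leq_eqVlt => /orP[/eqP<-|//].
- by rewrite transition_id.
- by rewrite transition_id.
by rewrite ltnS => le_nm; rewrite transitionS // chi_phi IHm.
Qed.

Definition sequential_system (M : nat -> lmodType R)
    (phi : forall n, {linear M n -> M n.+1}) : direct_system R.
Proof.
refine (@DirectSystem R nat (fun n m => n <= m)%N leqnn _ (inhabits 0) _ M
  (fun n m _ => transition phi n m) _ _).
- by move=> i j k le_ij; apply: leq_trans.
- by move=> i j; exists (maxn i j); rewrite leq_maxl leq_maxr.
- by move=> n _ x; exact: transition_id.
- by move=> n m p le_nm le_mp _ x; exact: transition_comp.
Defined.

(** The elementwise criterion, for a sequence of modules. *)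
Definition is_sequential_limit (M : nat -> lmodType R)
    (phi : forall n, {linear M n -> M n.+1}) (N : lmodType R)
    (psi : forall n, {linear M n -> N}) : Prop :=
  [/\ forall n x, psi n.+1 (phi n x) = psi n x,
      forall y, exists n x, y = psi n x &
      forall n x, psi n x = 0 -> exists2 m, (n <= m)%N & transition phi n m x = 0].

Section SequentialUniversal.
Variables (M : nat -> lmodType R) (phi : forall n, {linear M n -> M n.+1}).
Variables (N : lmodType R) (psi : forall n, {linear M n -> N}).
Hypothesis lim : is_sequential_limit phi psi.

Let cocone : @is_cocone R (sequential_system phi) N psi.
Proof.
by case: lim => psi_phi _ _ n m le_nm x; exact: (transition_cocone psi_phi x le_nm).
Qed.

Let surj y : exists n x, y = psi n x.
Proof. by case: lim. Qed.

Let ker n x : psi n x = 0 ->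
  exists m (le_nm : @dsys_le R (sequential_system phi) n m),
    @dsys_map R (sequential_system phi) n m le_nm x = 0.
Proof. by case: lim => _ _ kerx /kerx[m le_nm tr0]; exists m, le_nm. Qed.

Lemma sequential_limit_direct : is_direct_limit (sequential_system phi) N.
Proof. exact: direct_limit_criterion cocone surj ker. Qed.

Lemma sequential_limit_map (P : lmodType R) (chi : forall n, {linear M n -> P}) :
  (forall n x, chi n.+1 (phi n x) = chi n x) ->
  exists u : {linear N -> P}, forall n x, u (psi n x) = chi n x.
Proof.
move=> chi_cocone.
apply: (@direct_limit_map R (sequential_system phi) N psi cocone surj ker P chi).
by move=> n m le_nm x; exact: (transition_cocone chi_cocone x le_nm).
Qed.

End SequentialUniversal.

(** The limit is the submodule of the product modulo eventually zero sequences that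
    consists of the classes of the sequences x, phi x, phi (phi x), ... started at
    some index and preceded by zeros. *)
Lemma sequential_limit_exists M phi : exists N psi, @is_sequential_limit M phi N psi.
Proof.
pose S (x : product_type M) := exists n, forall m, (n <= m)%N -> x m = 0.
have [|Q [p pE]] := @quotient_module R (product_type M) S _.
  split=> [|a x y [n xn] [n' yn']]; first by exists 0.
  exists (maxn n n') => m; rewrite geq_max => /andP[/xn x0 /yn' y0].
  by rewrite product_linearE x0 y0 scaler0 addr0.
pose s n (x : M n) : product_type M :=
  fun m => if (n <= m)%N then transition phi n m x else 0.
have /dependent_choice[psi psiE] : forall n, exists psi : {linear M n -> Q},
    forall x, psi x = p (s n x).
  move=> n; apply: linear_map_of => a x y; rewrite -linearP; congr (p _).
  apply: functional_extensionality_dep => m; rewrite product_linearE /s.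
  by case: ifP => _; rewrite ?linearP // scaler0 addr0.
have eqp x y : S (x - y) -> p x = p y.
  by move/pE/eqP; rewrite linearB subr_eq0 => /eqP.
have cocone n x : psi n.+1 (phi n x) = psi n x.
  rewrite !psiE; apply: eqp; exists n.+1 => m lt_nm.
  have -> : (s n.+1 (phi n x) - s n x) m = s n.+1 (phi n x) m - s n x m by [].
  rewrite /s lt_nm ltnW //.
  have := transitionS phi x (leqnn n); rewrite transition_id => <-.
  by rewrite transition_comp // subrr.
have coconeT := transition_cocone cocone.
have [|N [j [inj_j jP]]] := @submodule_module R Q (fun y => exists n x, y = psi n x) _.
  split=> [|a _ _ [n [x ->]] [n' [x' ->]]]; first by exists 0, 0; rewrite linear0.
  exists (maxn n n').
  exists (a *: transition phi n (maxn n n') x + transition phi n' (maxn n n') x').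
  by rewrite linearP !coconeT // ?leq_maxl ?leq_maxr.
have /dependent_choice[chi chiE] : forall n, exists chi : {linear M n -> N},
    forall x, psi n x = j (chi x).
  by move=> n; apply: lift_to_submodule => // x; apply/jP; exists n, x.
exists N, chi; split=> [n x|y|n x].
- by apply: inj_j; rewrite -!chiE.
- have /jP[n [x jy]] : exists y', j y = j y' by exists y.
  by exists n, x; apply: inj_j; rewrite -chiE.
- move=> /(congr1 j); rewrite -chiE linear0 psiE => /pE[m sm0].
  exists (maxn n m); first exact: leq_maxl.
  by have := sm0 _ (leq_maxr n m); rewrite /s leq_maxl.
Qed.

End SequentialLimits.

(** * Modules over a finite dimensional algebra as vector spaces *)

Lemma dim_at_most_fin (K : fieldType) (V : lmodType K) (T : finType) (F : T -> V) :
  (forall v, exists c : T -> K, v = \sum_t c t *: F t) -> dim_at_most V #|T|.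
Proof.
move=> spF; pose b i := oapp (fun i : 'I_#|T| => F (enum_val i)) 0 (insub i).
apply: (@dim_at_most_span _ _ _ b) => v; have [c ->] := spF v.
apply: in_span_sum => t _.
have <- : b (enum_rank t) = F t by rewrite /b valK /= enum_rankK.
exact: in_span_gen.
Qed.

Section RestrictionOfScalars.
Variables (K : fieldType) (L : falgType K).

Section Restriction.
Variable M : lmodType L.

(** Restriction of scalars along the structure map of the algebra. *)
Definition restriction : Type := M.

HB.instance Definition _ := GRing.Zmodule.on restriction.

Definition restriction_scale (k : K) (x : restriction) : restriction :=
  (k%:A : L) *: (x : M).

Fact restriction_scalerA a b x :
  restriction_scale a (restriction_scale b x) = restriction_scale (a * b) x.
Proof. by rewrite /restriction_scale scalerA mulr_algl scalerA. Qed.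

Fact restriction_scale1r : left_id 1 restriction_scale.
Proof. by move=> x; rewrite /restriction_scale !scale1r. Qed.

Fact restriction_scalerDr : right_distributive restriction_scale +%R.
Proof. by move=> a x y; exact: scalerDr. Qed.

Fact restriction_scalerDl x : {morph restriction_scale^~ x : a b / a + b}.
Proof. by move=> a b; rewrite /restriction_scale !scalerDl. Qed.

HB.instance Definition _ := GRing.Zmodule_isLmodule.Build K restriction
  restriction_scalerA restriction_scale1r restriction_scalerDr restriction_scalerDl.

End Restriction.

Implicit Types M N X : lmodType L.

Lemma restriction_linear_sum M N (f : {linear M -> N}) n (c : nat -> K)
    (b : nat -> restriction M) :
  f (\sum_(i < n) c i *: b i) = \sum_(i < n) c i *: (f (b i) : restriction N).
Proof.
rewrite linear_sum; apply: eq_bigr => i _.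
exact: (linearZ_LR f (c i)%:A (b i : M)).
Qed.

Lemma Kbasis_finite M d : dim_at_most (restriction M) d ->
  exists (n : nat) (b : 'I_n -> M), Kbasis b.
Proof.
move=> dimM.
have [n [b [indb _ spb]]] := finite_span_in (fun=> True) dimM.
exists n, (fun i => b i); split=> [s c uniq_s sum0 i i_s|m].
  pose c' k := oapp (fun j : 'I_n => if j \in s then c j else 0) 0 (insub k).
  have c'E (j : 'I_n) : c' j = if j \in s then c j else 0 by rewrite /c' valK.
  have <- : c' i = c i by rewrite c'E i_s.
  have {}sum0 : \sum_(j <- s) c j *: b j = 0 := sum0.
  apply: indb => //; rewrite -[RHS]sum0 [RHS]big_uniq // [RHS]big_mkcond.
  apply: eq_bigr => j _; rewrite c'E; case: ifP => // _.
  exact: scale0r.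
have [c ->] := spb m I; exists (index_enum 'I_n), (fun i : 'I_n => c i).
by [].
Qed.

Lemma countable_Kbasis M (b : nat -> restriction M) : nat_basis b ->
  countably_infinite_Kdim M.
Proof.
move=> [indb spb]; exists (b : nat -> M); split=> [s c uniq_s sum0 i i_s|m].
  pose n := (\max_(j <- s) j).+1.
  have lt_sn j : j \in s -> (j < n)%N by move=> js; rewrite ltnS; exact: leq_bigmax_seq.
  pose c' k := if k \in s then c k else 0.
  have <- : c' i = c i by rewrite /c' i_s.
  apply: (indb n c'); last exact: lt_sn.
  have {}sum0 : \sum_(j <- s) c j *: b j = 0 := sum0.
  rewrite -[RHS]sum0 -(big_mkord xpredT (fun k => c' k *: b k)).
  transitivity (\sum_(k <- index_iota 0 n | k \in s) c k *: b k).
    rewrite [RHS]big_mkcond; apply: eq_bigr => k _; rewrite /c'; case: ifP => // _.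
    exact: scale0r.
  rewrite -big_filter; apply: perm_big; apply: uniq_perm => //.
    by rewrite filter_uniq // iota_uniq.
  move=> k; rewrite mem_filter mem_index_iota /= andb_idr // => /lt_sn.
  by [].
have [n [c ->]] := spb m; exists (index_iota 0 n), c.
by rewrite /Kcomb big_mkord.
Qed.

Lemma infinite_Kdim_countable M : countably_infinite_Kdim M -> infinite_Kdim M.
Proof.
move=> [e [inde _]] [n [b [_ spb]]].
have dimM : dim_at_most (restriction M) #|'I_n|.
  apply: (dim_at_most_fin (V := restriction M) (F := b)) => v; have [s [c ->]] := spb v.
  exists (fun i => \sum_(j <- s | j == i) c j); rewrite /Kcomb.
  transitivity (\sum_(i < n) \sum_(j <- s | j == i) (c j *: (b j : restriction M))).
    rewrite (exchange_big_dep xpredT) //=; apply: eq_bigr => j _.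
    by rewrite (big_pred1 j) // => k; rewrite eq_sym.
  by apply: eq_bigr => i _; rewrite scaler_suml; apply: eq_bigr => j /eqP->.
apply: (dimM e) => c sum0 i lt_in.
apply: (inde (index_iota 0 #|'I_n|.+1) c); rewrite ?iota_uniq //.
  by rewrite /Kcomb big_mkord.
by rewrite mem_index_iota.
Qed.

Lemma fg_finite_dim M : fg_module M -> exists d, dim_at_most (restriction M) d.
Proof.
move=> [n [x spx]].
pose E := vbasis {:L}.
pose T : finType := ('I_n * 'I_(\dim {:L}))%type.
pose F (t : T) : restriction M := (E`_t.2 : L) *: x t.1.
exists #|T|; apply: (dim_at_most_fin (F := F)) => m.
have [a ->] := spx m; exists (fun t => coord E t.2 (a t.1)).
rewrite -(pair_big xpredT xpredT (fun i j => coord E j (a i) *: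
   ((E`_j *: x i) : restriction M))) /=.
apply: eq_bigr => i _.
rewrite {1}(coord_vbasis (memvf (a i))) scaler_suml; apply: eq_bigr => j _.
by rewrite -mulr_algl -scalerA.
Qed.

Lemma finite_dim_span M d : dim_at_most (restriction M) d ->
  exists n (b : nat -> restriction M), forall v, in_span n b v.
Proof.
move=> dimM; have [n [b [_ _ spb]]] := finite_span_in (fun=> True) dimM.
by exists n, b => v; apply: spb.
Qed.

Lemma finite_dim_fg M d : dim_at_most (restriction M) d -> fg_module M.
Proof.
move=> /finite_dim_span[n [b spb]]; exists n, (fun i => b i) => m.
by have [c ->] := spb m; exists (fun i => (c i)%:A).
Qed.

Lemma subfactor_dim M N d : dim_at_most (restriction N) d -> subfactor M N ->
  dim_at_most (restriction M) d.
Proof.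
move=> dimN [U [j [p [inj_j /choice[l lE]]]]] b indb.
apply: (dimN (fun i => j (l (b i)))) => c sum0; apply: indb.
have rel0 : \sum_(i < d.+1) c i *: (l (b i) : restriction U) = 0.
  apply: inj_j; rewrite linear0 -[RHS]sum0.
  exact: (restriction_linear_sum j d.+1 c (fun i => l (b i))).
rewrite -[RHS](linear0 p) -[X in p X]rel0.
rewrite (restriction_linear_sum p d.+1 c (fun i => l (b i))).
by apply: eq_bigr => i _; rewrite lE.
Qed.

(** Any d + 1 elements of the limit come from one member of the system, and a
    dependence relation there maps to one in the limit. *)
Lemma direct_limit_dim (D : direct_system L) N d : is_direct_limit D N ->
  (forall i, dim_at_most (restriction (@dsys_obj L D i)) d) ->
  dim_at_most (restriction N) d.
Proof.
move=> /direct_limit_surj[psi cocone surj] dimD b indb.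
have common n : exists i (x : nat -> @dsys_obj L D i),
    forall k, (k < n)%N -> b k = psi i (x k).
  elim: n => [|n [i [x xE]]].
    by have [i] := dsys_inhabited D; exists i, (fun=> 0).
  have [j [y yE]] := surj (b n).
  have [k [le_ik le_jk]] := dsys_directed i j.
  exists k, (fun l => if (l < n)%N then dsys_map le_ik (x l) else dsys_map le_jk y).
  move=> l; rewrite ltnS leq_eqVlt => /orP[/eqP->|lt_ln].
    by rewrite ltnn cocone yE.
  by rewrite lt_ln cocone xE.
have [i [x xE]] := common d.+1.
apply: (dimD i x) => c sum0; apply: indb.
have := restriction_linear_sum (psi i) d.+1 c x.
rewrite sum0 linear0 => {2}->; apply: eq_bigr => k _.
by rewrite xE.
Qed.

(** Evaluation on a finite spanning family of M embeds the homomorphisms into a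
    finite power of X, in which every subset lies in the span of finitely many
    of its members. *)
Lemma hom_finite_span M X : fg_module M -> fg_module X ->
  exists (r : nat) (g : 'I_r -> {linear M -> X}), forall h : {linear M -> X},
    exists c : 'I_r -> K, forall x, h x = \sum_(i < r) (c i)%:A *: g i x.
Proof.
move=> /fg_finite_dim[d /finite_dim_span[n [b spb]]].
move=> /fg_finite_dim[d' /finite_dim_span[e [z spz]]].
pose V := {ffun 'I_n -> restriction X}.
have dimV : dim_at_most V #|{: 'I_n * 'I_e}|.
  pose F (t : 'I_n * 'I_e) : V := [ffun k => if k == t.1 then z t.2 else 0].
  apply: (@dim_at_most_fin _ _ _ F) => v.
  have /choice[a aE] : forall i, exists c : nat -> K, v i = \sum_(j < e) c j *: z j.
    by move=> i; apply: spz.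
  exists (fun t : 'I_n * 'I_e => a t.1 t.2); apply/ffunP => k.
  rewrite sum_ffunE -(pair_big xpredT xpredT
    (fun (i : 'I_n) (j : 'I_e) => (a i j *: F (i, j)) k)) /=.
  rewrite (bigD1 k) //= [X in _ + X]big1 => [|i /negPf nki].
    by rewrite addr0 aE; apply: eq_bigr => j _; rewrite !ffunE eqxx.
  by rewrite big1 // => j _; rewrite !ffunE eq_sym nki; exact: scaler0.
have [r [w [_ Sw spw]]] :=
  finite_span_in
    (fun v : V => exists g : {linear M -> X}, forall i, v i = g (b i)) dimV.
have /choice[g gE] : forall i : 'I_r, exists g : {linear M -> X},
    forall k, w i k = g (b k) by move=> i; apply: Sw.
exists r, g => h.
have [|c cE] := spw [ffun i : 'I_n => h (b i) : restriction X].
  by exists h => i; rewrite ffunE.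
exists (fun i => c i) => x; have [a ->] := spb x.
rewrite restriction_linear_sum.
under [RHS]eq_bigr => i _ do rewrite restriction_linear_sum.
transitivity (\sum_(i < r) c i *: (\sum_(k < n) a k *: (g i (b k) : restriction X)));
  last by [].
under [RHS]eq_bigr => i _ do rewrite scaler_sumr.
rewrite exchange_big; apply: eq_bigr => k _ /=.
move/ffunP/(_ k): cE; rewrite ffunE sum_ffunE => ->; rewrite scaler_sumr.
by apply: eq_bigr => i _; rewrite ffunE gE !scalerA mulrC.
Qed.

End RestrictionOfScalars.

(** * The construction over X *)

Section ModulesOver.
Variables (K : fieldType) (L : falgType K) (A : module_class L).
Hypothesis hAfg : forall M, A M -> fg_module M.
Hypothesis hAsum : closed_under_finite_direct_sums A.
Variables (X : lmodType L) (hX : fg_module X).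

Record over := Over { dom : lmodType L; str : {linear dom -> X} }.

Definition over_map (o o' : over) (h : {linear dom o -> dom o'}) : Prop :=
  forall x, str o' (h x) = str o x.

Definition factors_through (o o' : over) : Prop :=
  exists h : {linear dom o -> dom o'}, over_map h.

Lemma factors_trans o1 o2 o3 :
  factors_through o1 o2 -> factors_through o2 o3 -> factors_through o1 o3.
Proof. by move=> [h hE] [k kE]; exists (k \o h) => x /=; rewrite kE hE. Qed.

Lemma joint_sum n (o : 'I_n -> over) : (forall i, A (dom (o i))) ->
  exists2 o', A (dom o') &
    exists iota : forall i, {linear dom (o i) -> dom o'}, forall i, over_map (iota i).
Proof.
move=> /hAsum[S AS [iota [surj inj]]].
have [F FE] := direct_sum_map (fun i => str (o i)) surj inj.
by exists (Over F) => //; exists iota.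
Qed.

Lemma joint_pair o1 o2 : A (dom o1) -> A (dom o2) ->
  exists o, [/\ A (dom o), factors_through o1 o & factors_through o2 o].
Proof.
move=> A1 A2; pose o (i : 'I_2) := if i == ord0 then o1 else o2.
have [|o' Ao' [iota iotaE]] := @joint_sum 2 o; first by move=> i; rewrite /o; case: ifP.
exists o'; split=> //; first by exists (iota ord0); exact: (iotaE ord0).
by exists (iota ord_max); exact: (iotaE ord_max).
Qed.

(** Since K is central in the algebra, a K-combination of homomorphisms g_i from M
    to X factors through the direct sum of copies of M that carry the g_i, by a
    linear map whose components are the coefficients. *)
Lemma absorb_hom M : A M ->
  exists2 o, A (dom o) & forall g : {linear M -> X}, factors_through (Over g) o.
Proof.
move=> AM; have [r [g spg]] := hom_finite_span (hAfg AM) hX.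
have [//|o Ao [iota iotaE]] := @joint_sum r (fun i => Over (g i)).
exists o => // h; have [c cE] := spg h.
have [|k kE] := @linear_map_of _ M (dom o)
    (fun x => \sum_(i < r) iota i ((c i)%:A *: x)).
  move=> a x y; rewrite scaler_sumr -big_split; apply: eq_bigr => i _ /=.
  rewrite -linearP; congr (iota i _).
  by rewrite scalerDr !scalerA mulr_algl mulr_algr.
exists k => x /=; rewrite kE cE linear_sum; apply: eq_bigr => i _.
by rewrite (iotaE i) /= linearZ.
Qed.

Definition rigid_on (o : over) (S : dom o -> Prop) : Prop :=
  forall o' (k : {linear dom o -> dom o'}), A (dom o') -> over_map k ->
    forall x, S x -> k x = 0 -> x = 0.

(** Take h with maximal kernel: if k kills h x, then x is in the kernel of the
    composite of h and k, which is again a map over X, so x is in the kernel of h. *)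
Lemma rigid_image o : A (dom o) ->
  exists o' (h : {linear dom o -> dom o'}),
    [/\ A (dom o'), over_map h & rigid_on (fun y => exists x, y = h x)].
Proof.
move=> Ao; have [d dimo] := fg_finite_dim (hAfg Ao).
pose I := {p : {o' : over & {linear dom o -> dom o'}} |
            A (dom (projT1 p)) /\ over_map (projT2 p)}.
have i0 : I.
  by exists (existT (fun o' => {linear dom o -> dom o'}) o
    (idfun : {linear dom o -> dom o})).
have [|[[o' h] [/= Ao' hE]] maxh] := @maximal_subspace K (restriction (dom o)) I
    (fun i x => projT2 (sval i) x = 0) d dimo (inhabits i0).
  move=> i; split=> [|k v w v0 w0]; first exact: linear0.
  have := linearP (projT2 (sval i)) k%:A v w.
  by rewrite v0 w0 scaler0 addr0.
exists o', h; split=> // o2 k Ao2 kE _ [x ->] khx.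
have kh : over_map (k \o h) by move=> u /=; rewrite kE hE.
apply: (maxh (exist _ (existT (fun o' => {linear dom o -> dom o'}) o2
  (k \o h : {linear _ -> _})) (conj Ao2 kh))) => //= v ->.
exact: linear0.
Qed.

(** A step of the sequence: the object M_n over X with its core B_n. *)
Record stage := Stage {
  obj : over; core : lmodType L; incl : {linear core -> dom obj} }.

Definition in_core (s : stage) (x : dom (obj s)) : Prop := exists y, x = incl s y.

Record good_stage (s : stage) : Prop := GoodStage {
  good_dom : A (dom (obj s));
  good_inj : injective (incl s);
  good_rigid : rigid_on (@in_core s) }.

Record extends (s s' : stage) (h : {linear dom (obj s) -> dom (obj s')}) : Prop :=
  Extends {
    ext_over : over_map h;
    ext_core : forall x, in_core (h x);
    ext_new : exists y : core s', forall z : core s, incl s' y <> h (incl s z);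
    ext_approx : forall g : {linear dom (obj s) -> X},
      factors_through (Over g) (obj s') }.

Hypothesis no_approximation :
  ~ exists (M : lmodType L) (f : {linear M -> X}), is_approximation A A f.

Lemma unfactored_map o : A (dom o) ->
  exists2 o', A (dom o') & ~ factors_through o' o.
Proof.
move=> Ao; apply: contrapT => nounf; apply: no_approximation.
exists (dom o), (str o); split=> // N g AN.
have [h hE] : factors_through (Over g) o.
  by apply: contrapT => nog; apply: nounf; exists (Over g).
by exists h => x; rewrite hE.
Qed.

(** The new object o' is a rigid image of a sum o of o1, which absorbs all maps from
    the old object to X, and of o2, which does not factor through the old object;
    the new core is the image of o. *)
Lemma next_stage s : good_stage s ->
  exists2 s', good_stage s' & exists h, @extends s s' h.
Proof.
case=> As inj_s rig_s.
have [o1 A1 abs1] := absorb_hom As.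
have [o2 A2 unf2] := unfactored_map As.
have [o [Ao [f1 f1E] [f2 f2E]]] := joint_pair A1 A2.
have [o' [h [Ao' hE rig]]] := rigid_image Ao.
have [W [p [j [inj_j surj_p jE]]]] := image_factorization h.
have [f0 f0E] := abs1 (str (obj s)).
have o1_o' : factors_through o1 o' by exists (h \o f1) => x /=; rewrite hE f1E.
have core_h u : @in_core (Stage j) (h u) by exists (p u); rewrite jE.
exists (Stage j).
  split=> // o3 k Ao3 kE _ [w ->] /=; have [u ->] := surj_p w.
  by rewrite -jE => khu; apply: (rig _ k) => //; exists u.
have hff : over_map (o := obj s) (o' := o') (h \o f1 \o f0).
  by move=> x /=; rewrite hE f1E f0E.
exists (h \o f1 \o f0); split=> //= [|g]; last exact: factors_trans (abs1 g) o1_o'.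
(* If the old core mapped onto the new one, it would do so bijectively, by
   rigidity, and o2 would factor through the old core. *)
apply: contrapT => nonew; apply: unf2.
pose t : {linear core s -> dom o'} := (h \o f1 \o f0) \o incl s.
have inj_t : injective t.
  move=> x y /eqP; rewrite -subr_eq0 -linearB => /eqP t0.
  apply: inj_s; apply/eqP; rewrite -subr_eq0 -linearB; apply/eqP.
  by apply: (rig_s o' (h \o f1 \o f0)) => //; exists (x - y).
have [|l lE] := @lift_to_submodule _ _ _ _ t (h \o f2) inj_t.
  move=> c; have [y yE] := core_h (f2 c).
  apply: contrapT => noz; apply: nonew; exists y => z yz; apply: noz; exists z.
  by rewrite /= yE /= yz.
exists (incl s \o l) => c /=.
by rewrite -hff -[LHS]/(str o' (t (l c))) -lE /= hE f2E.
Qed.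

(** The zero core is rigid in every object over X; the empty direct sum provides a
    member of A. *)
Lemma initial_stage : exists s, good_stage s.
Proof.
have [|S AS _] := hAsum (n := 0) (M := fun=> X); first by case.
have [//|U [j [inj_j jP]]] := @submodule_module _ S (fun x => x = 0) _.
  by split=> // a v w -> ->; rewrite scaler0 addr0.
exists (@Stage (@Over S \0) U j); split=> //= o k _ _ x xU _.
by apply/jP.
Qed.

Lemma stage_sequence : exists s : nat -> stage,
  (forall n, good_stage (s n)) /\ forall n, exists h, @extends (s n) (s n.+1) h.
Proof.
have [s0 good0] := initial_stage.
have /choice[f fP] : forall s : {s | good_stage s}, exists s' : {s | good_stage s},
    exists h, @extends (sval s) (sval s') h.
  move=> [s good_s]; have [s' good' ext] := next_stage good_s.
  by exists (exist _ s' good').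
pose S n := iter n f (exist _ s0 good0).
by exists (fun n => sval (S n)); split=> n; [exact: svalP (S n) | exact: fP].
Qed.

End ModulesOver.

(** * The limit of the construction *)

Section StageLimit.
Variables (K : fieldType) (L : falgType K) (A : module_class L).
Hypothesis hAfg : forall M, A M -> fg_module M.
Variable X : lmodType L.
Variable s : nat -> stage X.
Variable phi : forall n, {linear dom (obj (s n)) -> dom (obj (s n.+1))}.
Hypothesis s_good : forall n, good_stage A (s n).
Hypothesis s_ext : forall n, extends (phi n).
Variables (N : lmodType L) (psi : forall n, {linear dom (obj (s n)) -> N}).
Hypothesis psi_lim : is_sequential_limit phi psi.

Let M n : lmodType L := dom (obj (s n)).
Let B n : lmodType L := core (s n).
Let C : module_class L := fun P => exists n, P = M n.

Lemma transition_over n m : (n <= m)%N ->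
  over_map (transition phi n m : {linear M n -> M m}).
Proof.
move=> le_nm x; apply: (transition_cocone (chi := fun k => str (obj (s k)))) => //.
by move=> k y; exact: ext_over.
Qed.

(** An element of the core that vanishes in the limit vanishes at a later stage,
    which rigidity forbids unless it is zero. *)
Lemma core_psi_injective n : injective (psi n \o incl (s n)).
Proof.
move=> x y /= /eqP; rewrite -subr_eq0 -!linearB => /eqP.
have [_ _ ker] := psi_lim; move=> /ker[m le_nm tr0].
apply/(good_inj (s_good n))/eqP; rewrite -subr_eq0 -linearB; apply/eqP.
apply: (good_rigid (s_good n) (good_dom (s_good m)) (transition_over le_nm)) => //.
by exists (x - y).
Qed.

Lemma core_map_exists : exists beta : forall n, {linear B n -> B n.+1},
  forall n y, phi n (incl (s n) y) = incl (s n.+1) (beta n y).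
Proof.
apply: (dependent_choice (P := fun n (b : {linear B n -> B n.+1}) =>
  forall y, phi n (incl (s n) y) = incl (s n.+1) (b y))) => n.
apply: (@lift_to_submodule _ _ _ _ (incl (s n.+1)) (phi n \o incl (s n))).
  exact: good_inj.
by move=> y; have [z zE] := ext_core (s_ext n) (incl (s n) y); exists z.
Qed.

(** The cores are interleaved with the modules M n, as M n maps into the core of
    the next stage, so both sequences have the same limit. *)
Lemma core_sequential_limit (beta : forall n, {linear B n -> B n.+1}) :
  (forall n y, phi n (incl (s n) y) = incl (s n.+1) (beta n y)) ->
  is_sequential_limit beta (fun n => psi n \o incl (s n)).
Proof.
move=> betaE; have [cocone surj ker] := psi_lim; split=> [n x|y|n x /= px0].
- by rewrite /= -betaE cocone.
- have [n [x ->]] := surj y; have [z zE] := ext_core (s_ext n) x.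
  by exists n.+1, z; rewrite /= -zE cocone.
exists n => //; rewrite transition_id.
by apply: core_psi_injective; rewrite linear0.
Qed.

(** An element of each new core that does not come from the previous core gives an
    infinite independent sequence in the limit. *)
Lemma limit_not_finite n (b : nat -> restriction N) : exists v, ~ in_span n b v.
Proof.
have [beta betaE] := core_map_exists.
have [cocone _ _] := psi_lim.
have /dependent_choice[y yE] : forall k, exists y : B k.+1,
    forall z : B k, incl (s k.+1) y <> phi k (incl (s k) z).
  by move=> k; exact: ext_new (s_ext k).
pose e k : restriction N := psi k.+1 (incl (s k.+1) (y k)).
pose P k (v : restriction N) := exists z : B k, v = psi k (incl (s k) z).
have subP k : subspace (P k).
  split=> [|a _ _ [z ->] [z' ->]]; first by exists 0; rewrite !linear0.
  by exists (a%:A *: z + z'); rewrite !linearP.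
have PS k v : P k v -> P k.+1 v.
  by move=> [z ->]; exists (beta k z); rewrite -betaE cocone.
have Pe j k : (j < k)%N -> P k (e j).
  elim: k => // k IHk; rewrite ltnS leq_eqVlt => /orP[/eqP->|/IHk/PS//].
  by exists (y k).
have inde : forall k, indep k e.
  apply: indep_step => k /(subspace_span (subP k) (fun i => Pe i k))[z].
  rewrite -[RHS]cocone betaE => /core_psi_injective yz.
  by apply: (yE k z); rewrite yz betaE.
apply: contrapT => /forallNP spb.
have dimN : dim_at_most (restriction N) n.
  by apply: (dim_at_most_span (b := b)) => v; apply: contrapT; exact: spb.
exact: (dimN e (inde _)).
Qed.

(** Each M n has a finite spanning family; together these are indexed by pairs of
    natural numbers, which are enumerated by [pickle]. *)
Lemma limit_countable_span : exists e : nat -> restriction N,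
  forall v, exists n, in_span n e v.
Proof.
have /dependent_choice[r] : forall n, exists r, exists b : nat -> restriction (M n),
    forall v, in_span r b v.
  move=> n; have [d /finite_dim_span] := fg_finite_dim (hAfg (good_dom (s_good n))).
  exact.
move=> /dependent_choice[b spb].
pose e p : restriction N :=
  if unpickle p is Some (n, i) then psi n (b n i) else 0.
exists e => v; have [_ surj _] := psi_lim; have [n [x ->]] := surj v.
have [c ->] := spb n x.
exists (\max_(i < r n) pickle (n, i : nat)).+1.
rewrite restriction_linear_sum; apply: in_span_sum => i _.
have <- : e (pickle (n, i : nat)) = psi n (b n i) by rewrite /e pickleK.
apply: in_span_gen; rewrite ltnS.
exact: (leq_bigmax (F := fun i : 'I_(r n) => pickle (n, i : nat))).
Qed.

Lemma limit_countable_dim : countably_infinite_Kdim N.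
Proof.
have [e spe] := limit_countable_span.
have [b basis_b] := nat_basis_exists spe limit_not_finite.
exact: countable_Kbasis basis_b.
Qed.

(** The finite class is {M n}: an approximation of it receives a map over X from
    M n, which is injective on the rigid core. *)
Lemma core_phantom n : phantom_first_kind A C X (B n).
Proof.
have AM := good_dom (s_good n).
have subB : subfactor (B n) (M n).
  exists (B n), (incl (s n)), idfun; split; first exact: good_inj.
  by move=> y; exists y.
split.
  have [d dimM] := fg_finite_dim (hAfg AM).
  exact: finite_dim_fg (subfactor_dim dimM subB).
exists (fun P => P = M n); split.
- exists 1, (fun=> M n) => P; split=> [->|[]//]; by exists ord0.
- by exists (M n).
- by move=> P ->; exists n.
move=> P f [AP approx]; have [k kE] := approx _ (str (obj (s n))) erefl.
exists (B n), (k \o incl (s n)), idfun; split=> [x y /= /eqP|y]; last by exists y.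
rewrite -subr_eq0 -!linearB => /eqP kxy0.
apply/(good_inj (s_good n))/eqP; rewrite -subr_eq0 -linearB; apply/eqP.
apply: (good_rigid (s_good n) (o' := Over f) (k := k)) => //.
by exists (x - y).
Qed.

Lemma limit_effective_phantom : effective_phantom A C X N.
Proof.
have [beta betaE] := core_map_exists.
split.
  right; exists (sequential_system beta); first exact: core_phantom.
  exact: sequential_limit_direct (core_sequential_limit betaE).
have lim := sequential_limit_direct psi_lim.
have closN : direct_limit_closure A N.
  apply: closure_limit lim => n; apply: closure_base; exact: good_dom.
have [f fE] : exists f : {linear N -> X}, forall n x, f (psi n x) = str (obj (s n)) x.
  apply: (sequential_limit_map psi_lim (chi := fun n => str (obj (s n)))).
  by move=> n x; exact: ext_over.
exists f; split=> // P g [n PE]; move: g; rewrite {}PE => g.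
have [h hE] := ext_approx (s_ext n) g.
exists (psi n.+1 \o h) => x /=; rewrite fE.
by rewrite -[LHS]hE.
Qed.

End StageLimit.

Lemma phantom_widen (R : nzRingType) (A C C' : module_class R) (X B : lmodType R) :
  (forall M, C M -> C' M) -> is_phantom A C X B -> is_phantom A C' X B.
Proof.
move=> CC'.
have first P : phantom_first_kind A C X P -> phantom_first_kind A C' X P.
  move=> [fgP [CB [fin ne sub phan]]]; split=> //; exists CB; split=> // M /sub.
  exact: CC'.
case=> [/first|[D phD lim]]; first by left.
by right; exists D => // i; apply: first.
Qed.

(** An approximation for the whole class is one for each finite subclass, so every
    phantom of the first kind is a subfactor of M. *)
Lemma phantom_dim (K : fieldType) (L : falgType K) (A : module_class L)
    (X M B : lmodType L) (f : {linear M -> X}) d :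
  is_approximation A A f -> dim_at_most (restriction M) d -> is_phantom A A X B ->
  dim_at_most (restriction B) d.
Proof.
move=> [AM approx] dimM.
have first P : phantom_first_kind A A X P -> dim_at_most (restriction P) d.
  move=> [_ [CB [_ _ sub phan]]]; apply: subfactor_dim dimM _.
  by apply: (phan M f); split=> // N g /sub; exact: approx.
case=> [/first//|[D phD lim]].
by apply: direct_limit_dim lim _ => i; apply: first.
Qed.

Lemma effective_phantom_exists (K : fieldType) (L : falgType K) (A : module_class L)
    (hAfg : forall M, A M -> fg_module M)
    (hAsum : closed_under_finite_direct_sums A)
    (X : lmodType L) (hX : fg_module X) :
  ~ (exists (M : lmodType L) (f : {linear M -> X}), is_approximation A A f) ->
  exists C : module_class L,
      [/\ forall M, C M -> A M, countable_class C &
          exists B : lmodType L,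
            effective_phantom A C X B /\ countably_infinite_Kdim B].
Proof.
move=> noapp; have [s [s_good /dependent_choice[phi s_ext]]] :=
  stage_sequence hAfg hAsum hX noapp.
have [N [psi lim]] := sequential_limit_exists phi.
exists (fun M => exists n, M = dom (obj (s n))); split.
- by move=> _ [n ->]; exact: good_dom (s_good n).
- by exists (fun n => dom (obj (s n))).
exists N; split; first exact: (limit_effective_phantom hAfg s_good s_ext lim).
exact: (limit_countable_dim hAfg s_good s_ext lim).
Qed.

Theorem theorem9 (K : fieldType) (L : falgType K) (hL : basic_algebra L)
    (A : module_class L) (hAfg : forall M, A M -> fg_module M)
    (hAsum : closed_under_finite_direct_sums A)
    (X : lmodType L) (hX : fg_module X) :
  let no_approximation :=
    ~ exists (M : lmodType L) (f : {linear M -> X}), is_approximation A A f in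
  let countable_effective_phantom :=
    exists C : module_class L,
      [/\ forall M, C M -> A M, countable_class C &
          exists B : lmodType L,
            effective_phantom A C X B /\ countably_infinite_Kdim B] in
  let infinite_phantom :=
    exists B : lmodType L, is_phantom A A X B /\ infinite_Kdim B in
  (no_approximation <-> countable_effective_phantom) /\
  (no_approximation <-> infinite_phantom).
Proof.
move=> no_approximation countable_effective_phantom infinite_phantom.
have imp12 : no_approximation -> countable_effective_phantom.
  exact: effective_phantom_exists.
have imp23 : countable_effective_phantom -> infinite_phantom.
  move=> [C [subC _ [B [[phB _] dimB]]]]; exists B; split.
    exact: phantom_widen phB.
  exact: infinite_Kdim_countable.
have imp31 : infinite_phantom -> no_approximation.
  move=> [B [phB infB]] [M [f approx]]; apply: infB.
  have [d dimM] := fg_finite_dim (hAfg M approx.1).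
  exact: Kbasis_finite (phantom_dim approx dimM phB).
by split; split; auto.
Qed.
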